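(* Let $p \neq 2$ be a prime, let $g \in \mathbb{Z}_p^\times$ and positive integers $n, k$ be fixed with $p \nmid k$, and let $e$ be a positive integer. Let $m$ be the multiplicative order of $g$ modulo $p$, let $d = \frac{\gcd(k,p-1)}{\gcd\left(k,\frac{p-1}{m}\right)}$, and let $d = q_1^{\alpha_1}q_2^{\alpha_2}\cdots q_i^{\alpha_i}$ be the prime factorization of $d$. Then there are exactly $$N = \frac{m\cdot\gcd(k,p-1)}{q_1^{\lceil \alpha_1/n\rceil}q_2^{\lceil \alpha_2/n\rceil}\cdots q_i^{\lceil \alpha_i/n\rceil}}$$ integers $x \in \{1,2,\ldots,p^e m\}$ satisfying $$g^{x^n} \equiv x^k \pmod{p^e}.$$
   Context: $\mathbb{Z}_p$ denotes the ring of $p$-adic integers and $\mathbb{Z}_p^\times$ its unit group. For $g \in \mathbb{Z}_p^\times$, the multiplicative order of $g$ modulo $p$ is the order of the image of $g$ in $(\mathbb{Z}/p\mathbb{Z})^\times$. Congruences modulo $p^e$ between elements of $\mathbb{Z}_p$ mean that the difference lies in $p^e\mathbb{Z}_p$. The prime factorization of $d$ has distinct primes $q_j$ and exponents $\alpha_j \ge 1$; if $d=1$ the product in the denominator is empty and equals $1$. *)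

(* Defs.v *)
From HB Require Import structures.
From mathcomp Require Import all_boot all_order all_algebra fingroup.
From mathcomp Require Import boolp classical_sets functions cardinality.

Set Implicit Arguments.
Unset Strict Implicit.
Unset Printing Implicit Defensive.

Import Order.TTheory GRing.Theory Num.Theory.
Local Open Scope ring_scope.

(* Z_p is the inverse limit of Z/p <- Z/p^2 <- Z/p^3 <- ... .  Level i holds
   the residue mod p ^ i.+1; the tower starts at Z/p because 'Z_1 is not the
   trivial ring.  The ring structure exists for every p : nat, but its meaning
   is only the intended one for 1 < p. *)
Definition Zpow_red (p i : nat) (x : 'Z_(p ^ i.+2)) : 'Z_(p ^ i.+1) :=
  (x : nat)%:R.

Record padic_int (p : nat) := PadicInt {
  padic_seq : forall i : nat, 'Z_(p ^ i.+1);
  padic_compat : forall i : nat, Zpow_red (padic_seq i.+1) = padic_seq i }.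

Section PadicRing.
Variable p : nat.

Lemma Zpow_char i : ((Zp_trunc (p ^ i.+2)).+2)%:R = 0 :> 'Z_(p ^ i.+1).
Proof.
have dvd : ((Zp_trunc (p ^ i.+1)).+2 %| (Zp_trunc (p ^ i.+2)).+2)%N.
  case: (leqP p 1) => [|p_gt1].
    by case: p => [|[|]] // _; rewrite ?exp0n ?exp1n.
  have gt1 j : (1 < p ^ j.+1)%N by rewrite -[1%N](expn0 p) ltn_exp2l.
  by rewrite !Zp_cast // dvdn_exp2l.
by rewrite Zp_nat; apply/val_inj/eqP.
Qed.

Lemma Zpow_red_nat i m : Zpow_red (m%:R : 'Z_(p ^ i.+2)) = m%:R.
Proof.
rewrite /Zpow_red (Zp_nat _ m) /= [in RHS](divn_eq m (Zp_trunc (p ^ i.+2)).+2).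
by rewrite natrD natrM Zpow_char mulr0 add0r.
Qed.

Lemma Zpow_red_is_additive i : zmod_morphism (@Zpow_red p i).
Proof.
have redD (x y : 'Z_(p ^ i.+2)) : Zpow_red (x + y) = Zpow_red x + Zpow_red y.
  by rewrite -[x]natr_Zp -[y]natr_Zp -natrD !Zpow_red_nat natrD.
by move=> x y; apply/eqP; rewrite eq_sym subr_eq -redD subrK.
Qed.

Lemma Zpow_red_is_monoid i : monoid_morphism (@Zpow_red p i).
Proof.
split=> [|x y]; first exact: (Zpow_red_nat i 1).
by rewrite -[x]natr_Zp -[y]natr_Zp -natrM !Zpow_red_nat natrM.
Qed.

HB.instance Definition _ i :=
  GRing.isZmodMorphism.Build _ _ (@Zpow_red p i) (@Zpow_red_is_additive i).
HB.instance Definition _ i :=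
  GRing.isMonoidMorphism.Build _ _ (@Zpow_red p i) (@Zpow_red_is_monoid i).

Local Notation Zp := (padic_int p).

HB.instance Definition _ := gen_eqMixin Zp.
HB.instance Definition _ := gen_choiceMixin Zp.

Lemma padicP (a b : Zp) : (forall i, padic_seq a i = padic_seq b i) -> a = b.
Proof.
case: a b => [a ca] [b cb] /= eq_ab.
have {}eq_ab : a = b by exact: functional_extensionality_dep.
by subst b; congr PadicInt; exact: Prop_irrelevance.
Qed.

Definition padic0 : Zp :=
  @PadicInt p (fun=> 0) (fun i => rmorph0 (@Zpow_red p i)).
Definition padic1 : Zp :=
  @PadicInt p (fun=> 1) (fun i => rmorph1 (@Zpow_red p i)).

Fact padic_opp_subproof (a : Zp) i :
  Zpow_red (- padic_seq a i.+1) = - padic_seq a i.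
Proof. by rewrite rmorphN /= !padic_compat. Qed.
Definition padic_opp a : Zp := PadicInt (padic_opp_subproof a).

Fact padic_add_subproof (a b : Zp) i :
  Zpow_red (padic_seq a i.+1 + padic_seq b i.+1) = padic_seq a i + padic_seq b i.
Proof. by rewrite rmorphD /= !padic_compat. Qed.
Definition padic_add a b : Zp := PadicInt (padic_add_subproof a b).

Fact padic_mul_subproof (a b : Zp) i :
  Zpow_red (padic_seq a i.+1 * padic_seq b i.+1) = padic_seq a i * padic_seq b i.
Proof. by rewrite rmorphM /= !padic_compat. Qed.
Definition padic_mul a b : Zp := PadicInt (padic_mul_subproof a b).

Fact padic_addA : associative padic_add.
Proof. by move=> a b c; apply: padicP => i /=; rewrite addrA. Qed.
Fact padic_addC : commutative padic_add.
Proof. by move=> a b; apply: padicP => i /=; rewrite addrC. Qed.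
Fact padic_add0 : left_id padic0 padic_add.
Proof. by move=> a; apply: padicP => i /=; rewrite add0r. Qed.
Fact padic_addN : left_inverse padic0 padic_opp padic_add.
Proof. by move=> a; apply: padicP => i /=; rewrite addNr. Qed.

HB.instance Definition _ :=
  GRing.isZmodule.Build Zp padic_addA padic_addC padic_add0 padic_addN.

Fact padic_mulA : associative padic_mul.
Proof. by move=> a b c; apply: padicP => i /=; rewrite mulrA. Qed.
Fact padic_mulC : commutative padic_mul.
Proof. by move=> a b; apply: padicP => i /=; rewrite mulrC. Qed.
Fact padic_mul1 : left_id padic1 padic_mul.
Proof. by move=> a; apply: padicP => i /=; rewrite mul1r. Qed.
Fact padic_mulDl : left_distributive padic_mul padic_add.
Proof. by move=> a b c; apply: padicP => i /=; rewrite mulrDl. Qed.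
Fact padic_1neq0 : padic1 != 0 :> Zp.
Proof.
apply/eqP => /(congr1 (fun a : Zp => padic_seq a 0)) /eqP.
by rewrite /= oner_eq0.
Qed.

HB.instance Definition _ := GRing.Zmodule_isComNzRing.Build Zp
  padic_mulA padic_mulC padic_mul1 padic_mulDl padic_1neq0.

Definition padic_unit : {pred Zp} := fun a => `[< exists b : Zp, b * a = 1 >].
Definition padic_inv (a : Zp) : Zp := xget a [set b : Zp | b * a = 1]%classic.

Fact padic_mulVx : {in padic_unit, left_inverse 1 padic_inv *%R}.
Proof.
move=> a /asboolP ex_inv.
exact: (@xgetPex _ a [set b : Zp | b * a = 1]%classic ex_inv).
Qed.
Fact padic_unitPl (a b : Zp) : b * a = 1 -> padic_unit a.
Proof. by move=> ba1; apply/asboolP; exists b. Qed.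
Fact padic_inv_out : {in [predC padic_unit], padic_inv =1 id}.
Proof.
move=> a /= /asboolPn noinv; rewrite /padic_inv.
by apply: xgetPN => b ba1; apply: noinv; exists b.
Qed.

HB.instance Definition _ := GRing.ComNzRing_hasMulInverse.Build Zp
  padic_mulVx padic_unitPl padic_inv_out.

(* 'Z_(p ^ 1) is convertible to 'Z_p. *)
Definition padic_res (a : Zp) : 'Z_p := padic_seq a 0.

Fact padic_res_is_additive : zmod_morphism padic_res.
Proof. by []. Qed.
Fact padic_res_is_monoid : monoid_morphism padic_res.
Proof. by []. Qed.

HB.instance Definition _ :=
  GRing.isZmodMorphism.Build Zp 'Z_p padic_res padic_res_is_additive.
HB.instance Definition _ :=
  GRing.isMonoidMorphism.Build Zp 'Z_p padic_res padic_res_is_monoid.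

Definition padic_res_unit (g : Zp) (Ug : g \is a GRing.unit) : {unit 'Z_p} :=
  FinRing.unit 'Z_p (rmorph_unit padic_res Ug).

Definition padic_modeq (e : nat) (a b : Zp) : Prop :=
  exists c : Zp, a - b = p%:R ^+ e * c.

End PadicRing.

Definition ceil_ratio (a n : nat) : nat := `|Num.ceil (a%:R / n%:R : rat)|%N.

(* Main.v *)
(* Count the solutions x modulo p ^ e * m by induction on e.  Each solution
   modulo p ^ e lifts to exactly one modulo p ^ e.+1, as in Hensel's lemma.
   For e = 1, the residues a modulo m and b modulo p of x vary independently
   and the congruence reads g ^ (a ^ n) = b ^ k.  Write g = z ^ s with z a
   primitive root modulo p, and G = gcd(k, p - 1): there are G solutions b if G
   divides s * a ^ n, and none otherwise.  That divisibility means d %| a ^ n,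
   i.e., a is a multiple of D = \prod_q q ^ ceil(alpha_q / n); and D divides m,
   so there are m / D such residues a. *)
Require Import Defs.
From mathcomp Require Import all_boot all_order all_algebra fingroup cyclic.
From mathcomp Require Import boolp classical_sets functions cardinality.
From mathcomp Require Import finmap ring.

Set Implicit Arguments.
Unset Strict Implicit.
Unset Printing Implicit Defensive.

Import Order.TTheory GRing.Theory Num.Theory.

(** * Counting residues by sums of 0/1 values *)

Lemma sum_affine_mod (N u a : nat) (F : nat -> nat) : coprime u N ->
  \sum_(t < N) F ((a + u * t) %% N) = \sum_(t < N) F t.
Proof.
case: N => [|N] cop_uN; first by rewrite !big_ord0.
pose h (t : 'I_N.+1) : 'I_N.+1 := inord ((a + u * t) %% N.+1).
have hE t : h t = (a + u * t) %% N.+1 :> nat by rewrite inordK ?ltn_pmod.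
have h_inj : injective h.
  move=> s t /(congr1 val); rewrite /= !hE => /eqP; rewrite eqn_modDl.
  wlog le_st : s t / s <= t.
    by move=> H; case: (leqP s t) => [|/ltnW] /H // Hts; rewrite eq_sym => /Hts.
  rewrite eq_sym eqn_mod_dvd ?leq_mul2l ?le_st ?orbT // -mulnBr.
  rewrite Gauss_dvdr 1?coprime_sym // -eqn_mod_dvd // !modn_small //.
  by move/eqP => ts; apply: val_inj.
by rewrite [RHS](reindex_inj h_inj); apply: eq_bigr => t _; rewrite hE.
Qed.

(** Reduction modulo [q] forces [c] and [w] to agree there. If they do, dividing by [q] leaves a
    linear congruence modulo [p], with one root [t] because [u] is invertible. *)
Lemma sum_linear_congruence (q p u c w : nat) : 0 < q -> 0 < p -> coprime u p ->
  \sum_(t < p) (c == w + q * (u * t) %[mod q * p]) = (c == w %[mod q]).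
Proof.
move=> q_gt0 p_gt0 cop_up.
have [/eqP cw | cw] := boolP (c == w %[mod q]); last first.
  apply: big1 => t _; apply/eqP; rewrite eqb0; apply: contra cw.
  move=> /eqP/(congr1 (modn^~ q)); rewrite !modn_dvdm ?dvdn_mulr // => ->.
  by rewrite addnC mulnC modnMDl.
(* The added multiple of [q * p] keeps the difference with [w] nonnegative. *)
have [z cz] : exists z, c + w * (q * p) = w + q * z.
  have le_w : w <= c + w * (q * p).
    by rewrite (leq_trans _ (leq_addl _ _)) // leq_pmulr ?muln_gt0 ?q_gt0.
  have : w == c + w * (q * p) %[mod q].
    by rewrite mulnCA addnC mulnC modnMDl cw.
  rewrite eq_sym eqn_mod_dvd // => /dvdnP[z zE].
  by exists z; rewrite [q * z]mulnC -zE subnKC.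
transitivity (\sum_(t < p) (z %% p == (0 + u * t) %% p)).
  apply: eq_bigr => t _; rewrite -(modnMDl w c) addnC cz eqn_modDl -!muln_modr.
  by rewrite eqn_pmul2l // add0n.
rewrite (sum_affine_mod 0 (fun y => z %% p == y)) //.
rewrite (bigD1 (Ordinal (ltn_pmod z p_gt0))) //= eqxx big1 // => t.
by rewrite -val_eqE /= eq_sym => /negPf->.
Qed.

Lemma sum_blocks (r M : nat) (F : nat -> nat) :
  \sum_(x < r * M) F x = \sum_(y < M) \sum_(t < r) F (y + M * t).
Proof.
rewrite exchange_big -(big_mkord xpredT) big_nat_mul big_mkord.
apply: eq_bigr => t _.
rewrite -[t * M]add0n mulSn [(M + _)%N]addnC.
rewrite [in X in \big[_/_]_(_ <= _ < X) _]addnC.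
rewrite -{2}(add0n (t * M)) big_addn addnK big_mkord.
by apply: eq_bigr => y _; rewrite mulnC.
Qed.

Lemma sum_dvdn (D m : nat) : 0 < D -> D %| m ->
  \sum_(a < m) (D %| a) = m %/ D.
Proof.
move=> D_gt0 /dvdnP[r ->]; rewrite (sum_blocks _ _ (fun a => D %| a)) mulnK //.
rewrite (bigD1 (Ordinal D_gt0)) //= [X in _ + X]big1 ?addn0 => [|y y_neq0].
  by rewrite (eq_bigr (fun=> 1)) ?sum1_card ?card_ord // => t _;
    rewrite add0n dvdn_mulr.
apply: big1 => t _; rewrite dvdn_addl ?dvdn_mulr //; apply/eqP; rewrite eqb0.
by rewrite gtnNdvd // lt0n.
Qed.

(** * Powers modulo prime powers *)

Lemma expnD_linear (x y k : nat) :
  exists q, (x + y) ^ k = x ^ k + k * x ^ k.-1 * y + q * y ^ 2.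
Proof.
elim: k => [|k [q IH]]; first by exists 0; rewrite !expn0 !mul0n.
exists (k * x ^ k.-1 + q * x + q * y); rewrite expnS IH /=.
(* [x * x ^ k.-1] is [x ^ k] only for positive [k]; at 0 the factor [k] kills the term. *)
case: k {IH} => [|k] /=; rewrite ?expn0 ?expn1 ?expnS; ring.
Qed.

(** For x = 1 + c p^i, the linear term of the expansion gains a factor p, and the remainder is
    divisible by p^(2i), where 2i >= i + 1. *)
Lemma modn1_expn_lift (p i x : nat) : 1 < p -> 0 < i -> x = 1 %[mod p ^ i] ->
  x ^ p = 1 %[mod p ^ i.+1].
Proof.
move=> p_gt1 i_gt0; have pi_gt1 : 1 < p ^ i by rewrite -(expn0 p) ltn_exp2l.
case: x => [|x]; first by rewrite mod0n modn_small.
move/eqP; rewrite eqn_mod_dvd // subn1 /= => /dvdnP[c ->].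
have [q] := expnD_linear 1 (c * p ^ i) p; rewrite add1n => ->.
rewrite !exp1n muln1 -addnA; apply/eqP.
rewrite -[X in _ == X %[mod _]]addn0 eqn_modDl mod0n; apply: dvdn_add.
  by rewrite mulnCA -expnS dvdn_mull.
rewrite expnMn -expnM !dvdn_mull // dvdn_exp2l //.
by rewrite muln2 -addnn -addn1 leq_add2l.
Qed.

(** Each further [p]-th power gains one power of [p]. The lifting step needs this period modulo
    [p ^ e.+1], not only modulo [p ^ e]. *)
Lemma expn_order_lift (p e m g : nat) : 1 < p -> g ^ m = 1 %[mod p] ->
  g ^ (p ^ e * m) = 1 %[mod p ^ e.+1].
Proof.
move=> p_gt1 gm; elim: e => [|e IH]; first by rewrite mul1n.
by rewrite expnS -mulnA mulnC expnM modn1_expn_lift.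
Qed.

Lemma eqn_mod_periodic (g d N a b : nat) : g ^ N = 1 %[mod d] ->
  a = b %[mod N] -> g ^ a = g ^ b %[mod d].
Proof.
move=> gN ab.
have red c : g ^ c = g ^ (c %% N) %[mod d].
  rewrite {1}(divn_eq c N) expnD mulnC [(_ * N)%N]mulnC expnM.
  by rewrite -modnMmr -modnXm gN modnXm exp1n modnMmr muln1.
by rewrite red ab -red.
Qed.

(** * Divisibility of [n]-th powers and the ceilings *)

Lemma ceil_ratio_leq (a n c : nat) : 0 < n ->
  (ceil_ratio a n <= c) = (a <= n * c).
Proof.
move=> n_gt0.
(* Nonnegativity makes the absolute value in [ceil_ratio] harmless. *)
have ge0 : (0 <= Num.ceil (a%:R / n%:R : rat))%R.
  by rewrite ceil_ge0 (lt_le_trans (ltrN10 _)) // divr_ge0 ?ler0n.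
rewrite -lez_nat /ceil_ratio gez0_abs // ceil_le_int ler_pdivrMr ?ltr0n //.
by rewrite -natrM ler_nat mulnC.
Qed.

Lemma dvdn_prod_primes (s : seq nat) (f : nat -> nat) (a : nat) :
  uniq s -> all prime s ->
  (\prod_(q <- s) q ^ f q %| a) = all (fun q => q ^ f q %| a) s.
Proof.
elim: s => [|q s IH] /=; first by rewrite big_nil dvd1n.
move=> /andP[qs uniq_s] /andP[q_pr s_pr]; rewrite big_cons Gauss_dvd ?IH //.
rewrite big_seq; apply: (big_ind (coprime (q ^ f q))) => [|x y|r rs].
  exact: coprimen1.
  by rewrite coprimeMr => -> ->.
apply/coprimeXl/coprimeXr; rewrite prime_coprime //.
by rewrite dvdn_prime2 ?(allP s_pr r rs) //; apply: contraNneq qs => ->.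
Qed.

(** Compare valuations at each prime q of [d]: alpha_q <= n v_q(a) means ceil(alpha_q / n) <=
    v_q(a). *)
Lemma dvdn_exp_ceil (d n a : nat) : 0 < d -> 0 < n ->
  (d %| a ^ n) = (\prod_(q <- primes d) q ^ ceil_ratio (logn q d) n %| a).
Proof.
move=> d_gt0 n_gt0; have [->|a_gt0] := posnP a.
  by rewrite exp0n // !dvdn0.
have all_pr : all prime (primes d).
  by apply/allP => q; rewrite mem_primes => /andP[].
rewrite {1}(prod_prime_decomp d_gt0) prime_decompE big_map /=.
rewrite !dvdn_prod_primes ?primes_uniq //.
apply: eq_in_all => q /(allP all_pr) q_pr.
by rewrite !pfactor_dvdn ?expn_gt0 ?a_gt0 // lognX ceil_ratio_leq.
Qed.

(** * The cyclic group of nonzero elements of ['F_p] *)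

Lemma Fp_expr_pred (p : nat) (b : 'F_p) : prime p -> (b != 0)%R ->
  (b ^+ (p - 1) = 1)%R.
Proof.
move=> p_pr b_neq0; apply: (mulfI b_neq0).
rewrite -exprS mulr1 subn1 prednK ?prime_gt0 // -[b]natr_Zp -natrX.
by rewrite -[LHS](Fp_nat_mod p_pr) fermat_little // Fp_nat_mod.
Qed.

Lemma prim_root_neq0 (F : fieldType) (N : nat) (z : F) :
  N.-primitive_root%R z -> (z != 0)%R.
Proof.
move=> z_prim; apply/eqP => z0; move: (prim_expr_order z_prim) => /eqP.
by rewrite z0 expr0n (gtn_eqF (prim_order_gt0 z_prim)) eq_sym oner_eq0.
Qed.

(** The nonzero elements are [p - 1] distinct roots of X^(p-1) - 1, and that many in a field include
    a primitive one. *)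
Lemma prime_field_prim_root (p : nat) : prime p ->
  exists z : 'F_p, (p - 1).-primitive_root%R z.
Proof.
move=> p_pr; have p_gt1 := prime_gt1 p_pr.
pose rs : seq 'F_p := [seq b <- index_enum 'F_p | b != 0%R].
have : has (p - 1).-primitive_root%R rs.
  apply: has_prim_root; rewrite ?subn_gt0 ?filter_uniq ?index_enum_uniq //.
    apply/allP => b; rewrite mem_filter => /andP[b_neq0 _].
    by apply/unity_rootP/Fp_expr_pred.
  have -> : size rs = #|predC1 (0%R : 'F_p)|.
    by rewrite -sum1_card -sum1_size big_filter.
  by rewrite cardC1 card_Fp // subn1.
by case/hasP => z _ z_prim; exists z.
Qed.

Lemma sum_prim_root (p : nat) (z : 'F_p) (F : 'F_p -> nat) : prime p ->
  (p - 1).-primitive_root%R z -> F 0%R = 0 ->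
  \sum_(b : 'F_p) F b = \sum_(j < p - 1) F (z ^+ j)%R.
Proof.
move=> p_pr z_prim F0; rewrite (bigD1 0%R) //= F0 add0n -big_filter.
rewrite -(big_mkord xpredT (fun j => F (z ^+ j)%R)) /index_iota subn0.
rewrite -(big_map (fun j => z ^+ j)%R xpredT F); apply: perm_big.
apply: uniq_perm; first by rewrite filter_uniq ?index_enum_uniq.
  rewrite map_inj_in_uniq ?iota_uniq // => i j.
  rewrite !mem_iota !add0n => /andP[_ i_lt] /andP[_ j_lt] /eqP.
  by rewrite (eq_prim_root_expr z_prim) !modn_small // => /eqP.
move=> b; rewrite mem_filter mem_index_enum andbT; apply/idP/mapP => [b_neq0|].
  have [j ->] := prim_rootP z_prim (Fp_expr_pred p_pr b_neq0).
  by exists (j : nat); rewrite ?mem_iota ?add0n //=.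
by case=> j _ ->; rewrite expf_neq0 // (prim_root_neq0 z_prim).
Qed.

(** Discrete logarithms turn the equation into i = k j modulo p - 1. Write k = k' G, p - 1 = P' G
    and j = y + P' t: if G divides i, then y is unique modulo P' and t takes G values. *)
Lemma sum_kth_roots (p k i : nat) (z : 'F_p) : prime p -> 0 < k ->
  (p - 1).-primitive_root%R z ->
  \sum_(b : 'F_p) (z ^+ i == b ^+ k)%R =
    (gcdn k (p - 1) %| i) * gcdn k (p - 1).
Proof.
move=> p_pr k_gt0 z_prim; set G := gcdn k (p - 1).
have p1_gt0 : 0 < p - 1 by rewrite subn_gt0 prime_gt1.
have G_gt0 : 0 < G by rewrite gcdn_gt0 k_gt0.
have zi_neq0 : (z ^+ i != 0)%R.
  by rewrite expf_neq0 // (prim_root_neq0 z_prim).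
rewrite (@sum_prim_root _ z) //; last first.
  by rewrite expr0n (gtn_eqF k_gt0) (negPf zi_neq0).
have [/dvdnP[k' kE] /dvdnP[P' PE]] : G %| k /\ G %| p - 1.
  by rewrite dvdn_gcdl dvdn_gcdr.
have P'_gt0 : 0 < P' by move: p1_gt0; rewrite PE muln_gt0 => /andP[].
have cop : coprime k' P'.
  have : gcdn k (p - 1) == 1 * G by rewrite mul1n.
  by rewrite {1}kE PE -muln_gcdl eqn_pmul2r.
transitivity (\sum_(j < G * P') (i == k * j %[mod G * P'])).
  rewrite mulnC -PE; apply: eq_bigr => j _.
  by rewrite -exprM mulnC (eq_prim_root_expr z_prim).
rewrite (sum_blocks _ _ (fun j => i == k * j %[mod G * P'] : nat)).
rewrite exchange_big /=.
transitivity (\sum_(t < G) (i == 0 %[mod G])).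
  apply: eq_bigr => t _.
  rewrite -[RHS](sum_linear_congruence i 0 G_gt0 P'_gt0 cop).
  apply: eq_bigr => y _; rewrite add0n kE.
  have -> : k' * G * (y + P' * t) = (k' * t) * (G * P') + G * (k' * y) by ring.
  by rewrite modnMDl.
by rewrite sum_nat_const card_ord mod0n mulnC.
Qed.

(** * The count for a natural number [g], later a representative of the p-adic base *)

Definition power_sol (g n k q x : nat) : bool := g ^ (x ^ n) == x ^ k %[mod q].

Section Count.
Variables (p k n m g : nat).
Hypotheses (p_prime : prime p) (n_gt0 : 0 < n) (k_gt0 : 0 < k).
Hypotheses (p_ndvd_k : ~~ (p %| k)) (m_gt0 : 0 < m).
Hypothesis order_g : forall j, (g ^ j == 1 %[mod p]) = (m %| j).

Local Notation sol e := (power_sol g n k (p ^ e)).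

Lemma coprime_base : coprime p g.
Proof.
rewrite prime_coprime //; apply/negP => /eqP pg.
move: (order_g m); rewrite dvdnn -modnXm pg.
by rewrite exp0n // mod0n modn_small // prime_gt1.
Qed.

Lemma order_dvd_pred : m %| p - 1.
Proof.
rewrite -order_g subn1 -totient_prime //; apply/eqP/Euler_exp_totient.
by rewrite coprime_sym coprime_base.
Qed.

Lemma coprime_order : coprime p m.
Proof.
have := order_dvd_pred; case: p p_prime => // [[|q]] //; rewrite subn1 /= => pr mq.
by rewrite coprime_sym; apply: coprime_dvdl mq _; rewrite coprimenS.
Qed.

(** Modulo [p] the right-hand side would vanish, while the left-hand side is a unit. *)
Lemma sol_ndvd e x : 0 < e -> p %| x -> sol e x = false.
Proof.
move=> e_gt0 px; apply/negP => /eqP/(congr1 (modn^~ p)).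
rewrite !modn_dvdm ?dvdn_exp // => /eqP.
have /eqP -> : p %| x ^ k by apply: dvdn_exp.
rewrite -[_ == 0]/(p %| _) => pg.
by have := coprimeXr (x ^ n) coprime_base; rewrite prime_coprime // pg.
Qed.

(* Hensel's lemma: along the class of [y] modulo [p ^ e * m], the left-hand side
   is constant modulo [p ^ e.+1], while the right-hand side is affine in the
   new digit [t], with slope prime to [p] unless [p] divides [y]. *)
Lemma sum_sol_lift e : 0 < e ->
  \sum_(x < p ^ e.+1 * m) sol e.+1 x = \sum_(x < p ^ e * m) sol e x.
Proof.
move=> e_gt0; have p_gt0 := prime_gt0 p_prime.
have -> : p ^ e.+1 * m = p * (p ^ e * m) by rewrite expnS mulnA.
rewrite (sum_blocks _ _ (fun x => sol e.+1 x : nat)).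
apply: eq_bigr => y _; have [py|py] := boolP (p %| y).
  rewrite sol_ndvd // big1 // => t _.
  by rewrite sol_ndvd // dvdn_add // -mulnA dvdn_mulr // dvdn_exp.
have gE t : g ^ ((y + p ^ e * m * t) ^ n) = g ^ (y ^ n) %[mod p ^ e.+1].
  apply: (@eqn_mod_periodic _ _ (p ^ e * m)).
    by apply: expn_order_lift; [exact: prime_gt1 | apply/eqP; rewrite order_g].
  by rewrite -modnXm addnC mulnC modnMDl modnXm.
(* The derivative of the [k]-th power at [y], times the [m] of the step [p ^ e * m]. *)
pose u := k * y ^ k.-1 * m.
have kE t :
    (y + p ^ e * m * t) ^ k = y ^ k + p ^ e * (u * t) %[mod p ^ e.+1].
  have [q ->] := expnD_linear y (p ^ e * m * t) k.
  have -> : k * y ^ k.-1 * (p ^ e * m * t) = p ^ e * (u * t).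
    by rewrite /u; ring.
  have /dvdnP[r ->] : p ^ e.+1 %| q * (p ^ e * m * t) ^ 2.
    rewrite !expnMn -expnM -mulnA dvdn_mull // dvdn_mulr // dvdn_exp2l //.
    by rewrite muln2 -addnn -addn1 leq_add2l.
  by rewrite addnC modnMDl.
transitivity (\sum_(t < p)
    (g ^ (y ^ n) == y ^ k + p ^ e * (u * t) %[mod p ^ e * p])).
  by apply: eq_bigr => t _; rewrite /power_sol gE kE expnSr.
rewrite sum_linear_congruence ?expn_gt0 ?p_gt0 //.
rewrite !coprimeMl ![coprime _ p]coprime_sym coprime_order.
by rewrite coprimeXr ?prime_coprime ?p_ndvd_k ?py.
Qed.

Local Notation G := (gcdn k (p - 1)).
Local Notation d := (G %/ gcdn k ((p - 1) %/ m)).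
Local Notation D := (\prod_(q <- primes d) q ^ ceil_ratio (logn q d) n).

(** The hypothesis says that gcd(s, p - 1) = (p - 1) / m, so gcd(k, (p - 1) / m) = gcd(G, s) and d =
    G / gcd(G, s). Cancelling gcd(G, s) leaves coprime factors. *)
Lemma gcd_dvd_mul s a : (p - 1) %/ gcdn s (p - 1) = m ->
  (G %| s * a) = (d %| a).
Proof.
move=> mE; have p1_gt0 : 0 < p - 1 by rewrite subn_gt0 prime_gt1.
have -> : d = G %/ gcdn G s.
  rewrite -mE; congr (_ %/ _).
  rewrite divnA ?dvdn_gcdr // mulKn // gcdnC [gcdn s _]gcdnC.
  by rewrite gcdnC gcdnA.
have [/dvdnP[G' GE] /dvdnP[s' sE]] : gcdn G s %| G /\ gcdn G s %| s.
  by rewrite dvdn_gcdl dvdn_gcdr.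
have c_gt0 : 0 < gcdn G s by rewrite gcdn_gt0 gcdn_gt0 k_gt0.
have cop : coprime G' s'.
  have : gcdn G s == 1 * gcdn G s by rewrite mul1n.
  by rewrite {1}GE {2}sE -muln_gcdl eqn_pmul2r.
rewrite {1 2}GE {2}sE mulnAC mulnK // dvdn_pmul2r //.
by rewrite Gauss_dvdr.
Qed.

Lemma d_gt0 : 0 < d.
Proof.
rewrite divn_gt0 ?gcdn_gt0 ?k_gt0 // dvdn_leq ?gcdn_gt0 ?k_gt0 //.
rewrite dvdn_gcd dvdn_gcdl (dvdn_trans (dvdn_gcdr _ _)) // dvdn_div //.
exact: order_dvd_pred.
Qed.

(** It suffices that [d] divides [m]. Taking s = (p - 1) / m in [gcd_dvd_mul] gives s m = p - 1, a
    multiple of [G]. *)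
Lemma D_dvd_m : D %| m.
Proof.
rewrite -dvdn_exp_ceil ?d_gt0 //; apply: dvdn_trans (dvdn_exp n_gt0 (dvdnn m)).
have s_dvd : (p - 1) %/ m %| p - 1 by rewrite dvdn_div ?order_dvd_pred.
rewrite -(@gcd_dvd_mul ((p - 1) %/ m)) ?divnK ?order_dvd_pred ?dvdn_gcdr //.
rewrite (gcdn_idPl s_dvd) -{1}(divnK order_dvd_pred) mulKn // divn_gt0 //.
by rewrite dvdn_leq ?order_dvd_pred ?subn_gt0 ?prime_gt1.
Qed.

Lemma sum_sol_base : \sum_(x < p ^ 1 * m) sol 1 x = m %/ D * G.
Proof.
have p_gt0 := prime_gt0 p_prime.
have [z z_prim] := prime_field_prim_root p_prime.
have p1_gt0 : 0 < p - 1 by rewrite subn_gt0 prime_gt1.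
have eqFp a b : (a == b %[mod p]) = (a%:R == b%:R :> 'F_p)%R.
  by rewrite -val_eqE /= !val_Fp_nat.
have [s gs] : {s : 'I_(p - 1) | (g%:R = z ^+ s :> 'F_p)%R}.
  apply: prim_rootP z_prim _ _; apply/eqP.
  by rewrite -natrX -[1%R]/(1%:R)%R -eqFp order_g order_dvd_pred.
(* Both sides are the order of z^s, so they divide the same exponents. *)
have mE : (p - 1) %/ gcdn s (p - 1) = m.
  have dvdE j : ((p - 1) %/ gcdn s (p - 1) %| j) = (m %| j).
    by rewrite -order_g eqFp natrX gs (prim_order_dvd (exp_prim_root z_prim s)).
  by apply/eqP; rewrite eqn_dvd dvdE dvdnn -dvdE dvdnn.
have -> : p ^ 1 * m = p * m by rewrite expn1.
rewrite (sum_blocks _ _ (fun x => sol 1 x : nat)).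
(* Since [g] has order [m], the left-hand side depends only on [y]; since [m] is prime to [p],
   [y + m * t] meets each residue modulo [p] once. *)
have solE y : \sum_(t < p) sol 1 (y + m * t) = (D %| y) * G.
  transitivity (\sum_(t < p) (g ^ (y ^ n) == ((y + m * t) %% p) ^ k %[mod p])).
    apply: eq_bigr => t _; rewrite /power_sol expn1 modnXm.
    congr (nat_of_bool (_ == _)); apply: (@eqn_mod_periodic _ _ m).
      by apply/eqP; rewrite order_g.
    by rewrite -modnXm addnC mulnC modnMDl modnXm.
  pose F b : nat := g ^ (y ^ n) == b ^ k %[mod p].
  rewrite (sum_affine_mod y F); last by rewrite coprime_sym coprime_order.
  rewrite -dvdn_exp_ceil ?d_gt0 // -(gcd_dvd_mul _ mE).
  rewrite -(sum_kth_roots _ p_prime k_gt0 z_prim).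
  rewrite -(big_mkord xpredT F).
  rewrite -{1}(Fp_cast p_prime) big_mkord; apply: eq_bigr => b _.
  by rewrite /F eqFp !natrX gs -exprM natr_Zp.
rewrite (eq_bigr _ (fun (y : 'I_m) _ => solE y)).
rewrite -big_distrl /= sum_dvdn ?D_dvd_m //.
by rewrite (dvdn_gt0 m_gt0 D_dvd_m).
Qed.

Lemma sum_sol e : 0 < e -> \sum_(x < p ^ e * m) sol e x = m %/ D * G.
Proof.
case: e => // e _; elim: e => [|e IH]; first exact: sum_sol_base.
by rewrite sum_sol_lift.
Qed.
End Count.

(** * From p-adic integers to natural numbers *)

Lemma eq_Zp_nat (N a b : nat) : 1 < N ->
  (a%:R == b%:R :> 'Z_N)%R = (a == b %[mod N]).
Proof. by move=> N_gt1; rewrite -val_eqE /= !val_Zp_nat. Qed.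

Lemma padic_seq_nat (p i x : nat) : padic_seq (x%:R : padic_int p)%R i = x%:R%R.
Proof. by elim: x => [|x IH] //; rewrite !mulrS -IH. Qed.

Lemma padic_seqM (p i : nat) (a b : padic_int p) :
  padic_seq (a * b)%R i = (padic_seq a i * padic_seq b i)%R.
Proof. by []. Qed.

Lemma padic_seqX (p i x : nat) (a : padic_int p) :
  padic_seq (a ^+ x)%R i = (padic_seq a i ^+ x)%R.
Proof. by elim: x => [|x IH] //; rewrite !exprS -IH. Qed.

Section Digits.
Variable p : nat.
Hypothesis p_gt1 : 1 < p.

Lemma pexp_gt1 i : 1 < p ^ i.+1.
Proof. by rewrite -(expn0 p) ltn_exp2l. Qed.

Lemma padic_seq_compat (a : padic_int p) i j : i <= j ->
  (padic_seq a j : nat) = padic_seq a i %[mod p ^ i.+1].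
Proof.
move/subnK <-; elim: (j - i) => [|l IH] //=.
rewrite -IH addSn -(padic_compat a (l + i)) /Zpow_red val_Zp_nat ?pexp_gt1 //.
by rewrite modn_dvdm // dvdn_exp2l // ltnS leq_addl.
Qed.

Lemma padic_dvd (e : nat) (a : padic_int p) : padic_seq a e = 0%R ->
  exists c : padic_int p, (a = p%:R ^+ e.+1 * c)%R.
Proof.
move=> ae; set q := p ^ e.+1.
have q_gt0 : 0 < q by rewrite expn_gt0 (ltnW p_gt1).
have q_dvd i : q %| padic_seq a (i + e.+1).
  rewrite /dvdn padic_seq_compat ?ae ?mod0n //.
  by rewrite addnS ltnW // ltnS leq_addl.
(* Division by [q] costs [e.+1] digits, so [a] is read that many levels higher. *)
pose c i : 'Z_(p ^ i.+1) := ((padic_seq a (i + e.+1) %/ q)%:R)%R.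
have c_compat i : Zpow_red (c i.+1) = c i.
  rewrite Zpow_red_nat; apply/eqP; rewrite eq_Zp_nat ?pexp_gt1 //.
  rewrite -(eqn_pmul2l q_gt0) !muln_modr ![q * (_ %/ q)]mulnC !divnK // mulnC.
  by rewrite -expnD addSn padic_seq_compat.
exists (PadicInt c_compat); apply: padicP => i.
rewrite padic_seqM -natrX padic_seq_nat -natrM -/q.
rewrite mulnC divnK // -[LHS]natr_Zp; apply/eqP; rewrite eq_Zp_nat ?pexp_gt1 //.
by rewrite padic_seq_compat // leq_addr.
Qed.

(** The shift arises because level [e] holds the residue modulo [p ^ e.+1]. *)
Lemma padic_modeqP (e : nat) (a b : padic_int p) :
  padic_modeq e.+1 a b <-> padic_seq a e = padic_seq b e.
Proof.
split=> [[c abE] | ab]; last by apply: padic_dvd; rewrite /= ab subrr.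
apply/eqP; rewrite -subr_eq0; apply/eqP.
rewrite -[LHS]/(padic_seq (a - b)%R e) abE.
rewrite padic_seqM -natrX padic_seq_nat.
by rewrite pchar_Zp ?mul0r ?pexp_gt1.
Qed.
End Digits.

Lemma card_eq_sum (M : nat) (f : pred nat) :
  ([set x | x < M /\ f x]%classic #= `I_(\sum_(x < M) f x)%classic)%card.
Proof.
pose X := [fset x in [seq x <- iota 0 M | f x]]%fset.
have -> : [set x | x < M /\ f x]%classic = [set` X]%classic.
  apply/seteqP; split=> x /=; rewrite !inE mem_filter mem_iota add0n /=.
    by case=> -> ->.
  by case/andP.
apply/card_eq_fsetP.
rewrite card_fseq undup_id ?filter_uniq ?iota_uniq //.
rewrite -(big_mkord xpredT (fun x => f x : nat)) -big_mkcond /=.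
by rewrite sum1_count size_filter /index_iota subn0.
Qed.

Theorem theorem8 (p : nat) (p_prime : prime p) (p_neq2 : p <> 2%N)
    (g : padic_int p) (Ug : g \is a GRing.unit)
    (n k e : nat) (n_gt0 : (0 < n)%N) (k_gt0 : (0 < k)%N)
    (p_ndvd_k : ~~ (p %| k)%N) (e_gt0 : (0 < e)%N) :
  let m := #[padic_res_unit Ug]%g in
  let d := (gcdn k (p - 1) %/ gcdn k ((p - 1) %/ m))%N in
  let D := (\prod_(q <- primes d) q ^ ceil_ratio (logn q d) n)%N in
  exists N : nat,
    (N%:R = (m * gcdn k (p - 1))%:R / D%:R :> rat)%R /\
    ([set x : nat | (1 <= x <= p ^ e * m)%N /\
       padic_modeq e (g ^+ (x ^ n)%N)%R (x%:R ^+ k)%R]%classic #= `I_N%classic)%card.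
Proof.
move=> m d D; have p_gt1 := prime_gt1 p_prime.
have m_gt0 : 0 < m by apply: order_gt0.
case: e e_gt0 => // e _; pose g0 : nat := padic_seq g e.
have order_g0 j : (g0 ^ j == 1 %[mod p]) = (m %| j).
  rewrite order_dvdn -val_eqE /= FinRing.val_unitX /=.
  rewrite -eq_Zp_nat // natrX; congr (_ ^+ _ == _)%R.
  rewrite -[RHS]natr_Zp; apply/eqP; rewrite eq_Zp_nat //; apply/eqP.
  exact: (padic_seq_compat p_gt1 g (leq0n e)).
have D_dvd : D %| m := D_dvd_m p_prime n_gt0 k_gt0 m_gt0 order_g0.
(* As [D] divides [m], the rational quotient is this natural number. *)
exists (m %/ D * gcdn k (p - 1)); split.
  rewrite divn_mulAC // pchar0_natf_div ?dvdn_mulr //.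
  exact: Num.Theory.pchar_num.
rewrite -(sum_sol p_prime n_gt0 k_gt0 p_ndvd_k m_gt0 order_g0 (ltn0Sn e)).
pose sol := power_sol g0 n k (p ^ e.+1).
have solP x : padic_modeq e.+1 (g ^+ (x ^ n))%R (x%:R ^+ k)%R <-> sol x.
  rewrite padic_modeqP // !padic_seqX padic_seq_nat -[padic_seq g e]natr_Zp.
  by rewrite -!natrX /sol /power_sol -eq_Zp_nat ?pexp_gt1 //; split=> /eqP.
(* The ranges differ only in the endpoints 0 and [p ^ e.+1 * m], which are multiples of [p] and
   hence not solutions. *)
have -> : [set x | 1 <= x <= p ^ e.+1 * m /\
    padic_modeq e.+1 (g ^+ (x ^ n))%R (x%:R ^+ k)%R]%classic =
  [set x | x < p ^ e.+1 * m /\ sol x]%classic.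
  have nsol x : p %| x -> sol x = false.
    exact: (sol_ndvd _ p_prime k_gt0 m_gt0 order_g0).
  apply/seteqP; split=> x /=.
    case=> /andP[_ xM] /solP sx; split=> //.
    rewrite ltn_neqAle xM andbT; apply: contraTneq sx => ->.
    by rewrite nsol // expnS -mulnA dvdn_mulr.
  case=> xM sx; split; last exact/solP.
  by rewrite (ltnW xM) andbT; case: x sx {xM} => //; rewrite nsol.
exact: card_eq_sum.
Qed.
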